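(* Let $X$ be a finite-dimensional real Hilbert space and let $T_1:X\to X$ and $T_2:X\to X$ be firmly nonexpansive such that each $T_i$ ($i\in\{1,2\}$) satisfies $$(\forall x\in X)(\forall y\in X)\qquad\inf_{z\in X}\langle T_ix-T_iz,(y-T_iy)-(z-T_iz)\rangle>-\infty.$$ Set $T:=T_2(2T_1-\mathrm{Id})+\mathrm{Id}-T_1$. Then $$\operatorname{ran}T\simeq(\operatorname{ran}T_1-\operatorname{ran}(\mathrm{Id}-T_2))\cap(\operatorname{ran}(\mathrm{Id}-T_1)+\operatorname{ran}T_2)$$ and $$\operatorname{ran}(\mathrm{Id}-T)\simeq(\operatorname{ran}T_1-\operatorname{ran}T_2)\cap(\operatorname{ran}(\mathrm{Id}-T_1)+\operatorname{ran}(\mathrm{Id}-T_2)).$$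
   Context: $T:X\to X$ is firmly nonexpansive if $\|Tx-Ty\|^2+\|(\mathrm{Id}-T)x-(\mathrm{Id}-T)y\|^2\le\|x-y\|^2$ for all $x,y\in X$. $T_2(2T_1-\mathrm{Id})$ denotes the composition of $T_2$ with $2T_1-\mathrm{Id}$. For $S\subseteq X$, $\operatorname{ri}S$ is the interior of $S$ relative to its affine hull. Near equality: $C\simeq D$ means $\overline{C}=\overline{D}$ and $\operatorname{ri}C=\operatorname{ri}D$. Sums and differences of sets are Minkowski sums and differences. *)

(* Defs.v *)
From HB Require Import structures.
From mathcomp Require Import all_boot all_order all_algebra.
From mathcomp Require Import all_classical all_reals all_analysis.

Set Implicit Arguments.
Unset Strict Implicit.
Unset Printing Implicit Defensive.

Import Order.TTheory GRing.Theory Num.Theory.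
Import numFieldNormedType.Exports.

Local Open Scope classical_set_scope.
Local Open Scope ring_scope.

(* A finite-dimensional real Hilbert space is rendered as X : normedVectType R
   (dimension 0 allowed; completeness is automatic) with an inner product
   inner : {dot X for idfun} such that inner_norm inner holds, so that the norm
   and the topology of X are the ones induced by the inner product. *)
#[short(type="normedVectType")]
HB.structure Definition NormedVector (R : numDomainType) :=
  {X of NormedModule R X & Vector R X}.

Definition inner_norm (R : realType) (X : normedModType R)
    (inner : {dot X for idfun}) : Prop :=
  forall x : X, `|x| ^+ 2 = inner x x.

Definition firmly_nonexpansive (R : realType) (X : normedModType R)
    (T : X -> X) : Prop :=
  forall x y : X,
    `|T x - T y| ^+ 2 + `|(id \- T) x - (id \- T) y| ^+ 2 <= `|x - y| ^+ 2.

Definition minkowski_add (V : zmodType) (A B : set V) : set V :=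
  [set a + b | a in A & b in B].

Definition minkowski_sub (V : zmodType) (A B : set V) : set V :=
  [set a - b | a in A & b in B].

Definition affine_set (R : realType) (V : lmodType R) (A : set V) : Prop :=
  forall (x y : V) (t : R), A x -> A y -> A (t *: x + (1 - t) *: y).

Definition affine_hull (R : realType) (V : lmodType R) (S : set V) : set V :=
  smallest (@affine_set R V) S.

(* Points outside affine_hull S are isolated in subspace (affine_hull S), but
   none of them belongs to S, so this is exactly the relative interior. *)
Definition relint (R : realType) (X : normedModType R) (S : set X) : set X :=
  @interior (subspace (affine_hull S)) S.

Definition near_equal (R : realType) (X : normedModType R) (C D : set X) : Prop :=
  closure C = closure D /\ relint C = relint D.

(* Main.v *)
Require Import Defs.
From HB Require Import structures.
From mathcomp Require Import all_boot all_order all_algebra.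
From mathcomp Require Import all_classical all_reals all_analysis.
From mathcomp Require Import ring lra.

Set Implicit Arguments.
Unset Strict Implicit.
Unset Printing Implicit Defensive.

Import Order.TTheory GRing.Theory Num.Theory.
Import numFieldNormedType.Exports.

Local Open Scope classical_set_scope.
Local Open Scope ring_scope.

(** Write F = Id - T for the displacement of the Douglas-Rachford operator T.
With y = 2 T1 x - x, one has F x = T1 x - T2 y = (x - T1 x) + (y - T2 y), so
ran F lies in the set E = (ran T1 - ran T2) `&` (ran (Id - T1) + ran (Id - T2)).
The two hypotheses on infima say that T1 and T2 are resolvents of rectangular
(3* monotone) operators.  Writing w in E in its two ways and adding one such
lower bound for T1 and one for T2 gives a Brezis-Haraux condition on F at w:
for some u, the map x |-> <w - F x, u - x> is bounded below
([douglas_rachford_displ_bounded]).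

This condition alone, for a nonexpansive T, forces ran F and E to be nearly
equal ([near_equal_range]).  For e > 0 let x_e solve w = e x_e + F x_e.
- The condition at w bounds e |x_e|^2, so w - F x_e = e x_e tends to 0 and E is
  contained in the closure of ran F ([range_closure]).  Affine subspaces are
  closed, so both sets have the same affine hull; its direction U contains
  every x_e.
- If w is in the relative interior of E, the condition also holds at w + v for
  all small v in U, and bounds <v, x_e> above uniformly in e <= 1.  As v ranges
  over U, this bounds |x_e|; by compactness |w - F x| then attains the value 0,
  and w is in ran F ([relint_range]).

The statement on ran T is the statement on ran (Id - T) for the pair
(T1, Id - T2), because the Douglas-Rachford operator of that pair is Id - T
([douglas_rachford_compl]) and both hypotheses on T2 are invariant under
T2 |-> Id - T2. *)

(** * Inner product identities *)

Lemma inner_sym (R : realType) (X : lmodType R) (inner : {dot X for idfun}) (x y : X) :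
  inner x y = inner y x.
Proof. by rewrite hermC /= expr0 mul1r. Qed.

Lemma normD2 (R : realType) (X : normedModType R) (inner : {dot X for idfun})
    (Hinner : inner_norm inner) (x y : X) :
  `|x + y| ^+ 2 = `|x| ^+ 2 + 2 * inner x y + `|y| ^+ 2.
Proof.
rewrite !Hinner linearDl /= !linearDr /= (inner_sym inner y x); ring.
Qed.

Lemma normB2 (R : realType) (X : normedModType R) (inner : {dot X for idfun})
    (Hinner : inner_norm inner) (x y : X) :
  `|x - y| ^+ 2 = `|x| ^+ 2 - 2 * inner x y + `|y| ^+ 2.
Proof. by rewrite (normD2 Hinner) normrN linearNr /= mulrN. Qed.

Lemma cauchy_schwarz (R : realType) (X : normedModType R) (inner : {dot X for idfun})
    (Hinner : inner_norm inner) (x y : X) :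
  inner x y <= `|x| * `|y|.
Proof.
have := normD2 Hinner x y; have := ler_normD x y.
have := normr_ge0 (x + y); have := normr_ge0 x; have := normr_ge0 y; nra.
Qed.

Lemma firmly_nonexpansiveP (R : realType) (X : normedModType R)
    (inner : {dot X for idfun}) (Hinner : inner_norm inner) (T : X -> X) :
  firmly_nonexpansive T <->
  forall x y, `|T x - T y| ^+ 2 <= inner (x - y) (T x - T y).
Proof.
have E x y : `|(id \- T) x - (id \- T) y| ^+ 2 =
    `|x - y| ^+ 2 - 2 * inner (x - y) (T x - T y) + `|T x - T y| ^+ 2.
  by rewrite -(normB2 Hinner) /= [in LHS]opprD addrACA -opprD.
split=> h x y; move: (h x y); rewrite E; lra.
Qed.

(** * Topology of finite-dimensional normed spaces *)

Definition of_coords (R : realType) (X : normedVectType R)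
    (u : 'rV[R]_(\dim {:X})) : X :=
  \sum_i u 0 i *: (vbasis {:X})`_i.

Definition coords (R : realType) (X : normedVectType R) (x : X)
    : 'rV[R]_(\dim {:X}) :=
  \row_i coord (vbasis {:X}) i x.

Lemma coordsK (R : realType) (X : normedVectType R) :
  cancel (@coords R X) (@of_coords R X).
Proof.
move=> x; rewrite [RHS](coord_vbasis (memvf x)).
by apply: eq_bigr => i _; rewrite mxE.
Qed.

Lemma of_coordsK (R : realType) (X : normedVectType R) :
  cancel (@of_coords R X) (@coords R X).
Proof.
move=> u; apply/rowP => i; rewrite mxE.
by rewrite coord_sum_free// (basis_free (vbasisP _)).
Qed.

Lemma of_coordsZ (R : realType) (X : normedVectType R) (k : R)
    (u : 'rV[R]_(\dim {:X})) : of_coords (k *: u) = k *: of_coords u.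
Proof.
by rewrite scaler_sumr; apply: eq_bigr => i _; rewrite mxE scalerA.
Qed.

Lemma of_coords_continuous (R : realType) (X : normedVectType R) :
  continuous (@of_coords R X).
Proof.
apply: continuous_big => [|i _ u]; first exact: add_continuous.
exact: (continuous_comp (@coord_continuous R 1 _ 0 i u) (@scalel_continuous _ _ _ _)).
Qed.

Lemma coord_le_norm (R : realType) n (u : 'rV[R]_n) i : `|u 0 i| <= `|u|.
Proof.
rewrite [leRHS]/Num.norm /= mx_normrE.
exact: (le_bigmax _ (fun ij : 'I_1 * 'I_n => `|u ij.1 ij.2|) (0, i)).
Qed.

(** Equivalence of norms: on the compact unit sphere of coordinate vectors, the
norm of the represented vector has a minimum, which is positive because a
vector of coordinates of norm 1 cannot represent 0. *)
Lemma coords_bounded (R : realType) (X : normedVectType R) :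
  exists2 K : R, 0 <= K & forall x : X, `|coords x| <= K * `|x|.
Proof.
pose S := [set u : 'rV[R]_(\dim {:X}) | `|u| = 1].
have inS u : u != 0 -> S (`|u|^-1 *: u).
  by move=> u0; rewrite /S /= normrZ normfV normr_id mulVf// normr_eq0.
(* The sphere is empty exactly when X is the zero space. *)
have [S0|S0] := pselect (S !=set0); last first.
  exists 0 => // x; rewrite mul0r; have [->|x0] := eqVneq (coords x) 0.
    by rewrite normr0.
  by case: S0; exists (`|coords x|^-1 *: coords x); exact: inS.
have cS : compact S.
  apply: bounded_closed_compact.
    by exists 1; split => // M M1 u /= ->; exact: ltW.
  rewrite -[S]/(Num.norm @^-1` [set (1 : R)]).
  apply: preimage_closed; last exact: closed_eq.
  by move=> u _; exact: norm_continuous.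
have [u uS umin] : exists2 u, u \in S &
    forall v, v \in S -> `|of_coords u| <= `|of_coords v|.
  apply: compact_EVT_min => //; apply: continuous_subspaceT => u.
  apply: continuous_comp; first exact: of_coords_continuous.
  exact: norm_continuous.
have m0 : 0 < `|of_coords u|.
  rewrite normr_gt0; apply/eqP => u0; move: uS; rewrite inE /S /=.
  rewrite -[u]of_coordsK u0 -(scale0r 0).
  have -> : coords (0 *: 0 : X) = 0.
    by apply/rowP => i; rewrite !mxE linearZ /= mul0r.
  by rewrite normr0 => /esym/eqP; rewrite oner_eq0.
exists `|of_coords u|^-1; first by rewrite invr_ge0.
move=> x; have [->|x0] := eqVneq (coords x) 0.
  by rewrite normr0 mulr_ge0 ?invr_ge0.
have := umin _ (mem_set (inS _ x0)).
rewrite of_coordsZ coordsK normrZ normfV normr_id mulrC.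
by rewrite ler_pdivlMr ?normr_gt0// ler_pdivlMl.
Qed.

Lemma linear_continuous_findim (R : realType) (X : normedVectType R)
    (Y : normedModType R) (f : {linear X -> Y}) : continuous f.
Proof.
have [K K0 KP] := coords_bounded X.
apply: bounded_linear_continuous; apply/bounded_funP => r.
exists (\sum_(i < \dim {:X}) K * r * `|f (vbasis {:X})`_i|) => x xr.
rewrite (coord_vbasis (memvf x)) linear_sum.
apply: le_trans (ler_norm_sum _ _ _) _; apply: ler_sum => i _.
rewrite linearZ /= normrZ ler_wpM2r// (le_trans _ (ler_wpM2l K0 xr))//.
apply: le_trans (KP x); apply: le_trans (coord_le_norm _ i).
by rewrite mxE.
Qed.

Lemma closed_ball_compact_findim (R : realType) (X : normedVectType R) (r : R) :
  compact [set x : X | `|x| <= r].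
Proof.
have [K K0 KP] := coords_bounded X.
have -> : [set x : X | `|x| <= r] =
    @of_coords R X @` [set u | `|of_coords u| <= r].
  apply/seteqP; split=> [x /= xr|_ [u /= ur <-]//].
  by exists (coords x); rewrite /= coordsK.
apply: continuous_compact.
  by apply: continuous_subspaceT; exact: of_coords_continuous.
apply: bounded_closed_compact.
  exists (K * r); split; first by rewrite num_real.
  move=> M ltM u /= ur; apply: le_trans (ltW ltM).
  by rewrite -[u]of_coordsK (le_trans (KP _))// ler_wpM2l.
rewrite -[X in closed X]/((Num.norm \o @of_coords R X) @^-1` [set x | x <= r]).
apply: preimage_closed.
  move=> u _; apply: continuous_comp; first exact: of_coords_continuous.
  exact: norm_continuous.
exact: closed_le.
Qed.

Lemma vspace_closed (R : realType) (X : normedVectType R) (U : {vspace X}) :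
  closed [set x | x \in U].
Proof.
have -> : [set x | x \in U] = (\1 - projv U)%VF @^-1` [set 0].
  apply/seteqP; split => x /=; rewrite lfunE /= lfunE /= lfunE /=.
    by move=> xU; rewrite projv_id// subrr.
  by move/subr0_eq => ->; exact: memv_proj.
apply: preimage_closed => [x _|]; first exact: linear_continuous_findim.
exact/accessible_closed_set1/hausdorff_accessible/norm_hausdorff.
Qed.

(** A finite-dimensional uniform boundedness principle.  Testing against the
basis vectors of U and their opposites bounds each <b_i, x>, and
|x|^2 = sum_i x_i <b_i, x> with coordinates |x_i| <= k_i |x|. *)
Lemma bounded_of_inner (R : realType) (X : normedVectType R)
    (inner : {dot X for idfun}) (Hinner : inner_norm inner)
    (U : {vspace X}) (P : set X) :
  (forall x, P x -> x \in U) ->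
  (forall v, v \in U -> exists c, forall x, P x -> inner v x <= c) ->
  exists M, forall x, P x -> `|x| <= M.
Proof.
move=> PU PM; set b := vbasis U.
have bU i : b`_i \in U.
  have [ib|ib] := ltnP i (size b); first exact/vbasis_mem/mem_nth.
  by rewrite nth_default// mem0v.
have /choice[c cP] i : exists c, forall x, P x -> `|inner b`_i x| <= c.
  have [c1 c1P] := PM _ (bU i); have bUN : - b`_i \in U by rewrite memvN.
  have [c2 c2P] := PM _ bUN; exists (Num.max c1 c2) => x Px.
  have := c2P _ Px; rewrite linearNl /= => c2x.
  by rewrite ler_norml lerNl !le_max c1P// c2x orbT.
have /choice[k kP] (i : 'I_(\dim U)) : exists k, 0 <= k /\
    forall x, `|coord b i x| <= k * `|x|.
  have : continuous (coord b i : {linear X -> R^o}) by exact: linear_continuous_findim.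
  move=> /linear_bounded_continuous/linear_boundedP/pinfty_ex_gt0[k k0 kP].
  by exists k; split; first exact: ltW.
exists (\sum_i k i * c i) => x Px.
have [->|x0] := eqVneq x 0.
  rewrite normr0 sumr_ge0// => i _; rewrite mulr_ge0//; first exact: (kP i).1.
  exact: le_trans (cP i x Px).
have xx : `|x| * `|x| <= `|x| * \sum_i k i * c i.
  rewrite -expr2 Hinner [X in inner _ X](coord_vbasis (PU _ Px)) linear_sum /=.
  rewrite mulr_sumr; apply: ler_sum => i _.
  rewrite linearZ /= inner_sym.
  rewrite (le_trans (ler_norm _))// normrM mulrA [_ * k i]mulrC.
  by rewrite ler_pM//; [exact: (kP i).2|exact: cP].
by move: xx; rewrite ler_pM2l// normr_gt0.
Qed.

(** * Affine sets and near equality *)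

Lemma affine_hull_affine (R : realType) (V : lmodType R) (S : set V) :
  affine_set (affine_hull S).
Proof.
move=> x y t Sx Sy A [affA SA].
exact: affA (Sx A (conj affA SA)) (Sy A (conj affA SA)).
Qed.

(** The translate of A by - w is closed under scaling and addition, hence it
contains, and by dimension count equals, a subspace of maximal dimension. *)
Lemma affine_direction (R : realType) (X : vectType R) (A : set X) (w : X) :
  affine_set A -> A w -> exists U : {vspace X}, forall v, v \in U <-> A (w + v).
Proof.
move=> affA Aw.
have AZ v t : A (w + v) -> A (w + t *: v).
  move=> Awv; have := affA _ _ t Awv Aw.
  by rewrite scalerDr addrAC -scalerDl [t + _]addrC subrK scale1r.
have AD u v : A (w + u) -> A (w + v) -> A (w + (u + v)).
  move=> Au Av; have := AZ _ 2 (_ : A (w + 2^-1 *: (u + v))).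
  rewrite scalerA divff// scale1r; apply.
  have := affA _ _ 2^-1 Au Av; rewrite (_ : 1 - 2^-1 = 2^-1 :> R); last by field.
  rewrite -scalerDr addrACA scalerDr -[w + w]mulr2n -[w *+ 2]scaler_nat scalerA.
  by rewrite mulVf// scale1r.
pose P n := `[< exists2 U : {vspace X},
  (forall v, v \in U -> A (w + v)) & \dim U = n >].
have Pex : exists n, P n.
  exists 0%N; apply/asboolP; exists 0%VS; last exact: dimv0.
  by move=> v; rewrite memv0 => /eqP ->; rewrite addr0.
have Pub n : P n -> (n <= \dim {:X})%N.
  by move=> /asboolP[U _ <-]; rewrite dimvS// subvf.
case: (ex_maxnP Pex Pub) => n /asboolP[U UA Un] maxn.
exists U => v; split=> [|Av]; first exact: UA.
apply/negPn/negP => vU.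
have : P (\dim (U + <[v]>)%VS).
  apply/asboolP; exists (U + <[v]>)%VS => // _ /memv_addP[u uU [_ /vlineP[k ->] ->]].
  by apply: AD; [exact: UA|exact: AZ].
move=> /maxn; rewrite -Un leqNgt => /negP; apply.
rewrite ltn_neqAle dimvS ?addvSl// andbT.
apply/eqP => dimE; case/negP: vU.
have /eqP -> : U == (U + <[v]>)%VS by rewrite eqEdim addvSl dimE leqnn.
by rewrite (subvP (addvSr _ _))// memv_line.
Qed.

Lemma affine_closed (R : realType) (X : normedVectType R) (A : set X) :
  affine_set A -> closed A.
Proof.
move=> affA; have [[w Aw]|A0] := pselect (A !=set0); last first.
  suff -> : A = set0 by exact: closed0.
  by apply/seteqP; split => // x Ax; case: A0; exists x.
have [U UA] := affine_direction affA Aw.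
have -> : A = (fun x => x - w) @^-1` [set v | v \in U].
  apply/seteqP; split=> x /=; last by move/UA; rewrite [w + _]addrC subrK.
  by move=> Ax; apply/UA; rewrite [w + _]addrC subrK.
apply: preimage_closed => [x _|]; last exact: vspace_closed.
by apply: continuousB => //; exact: cst_continuous.
Qed.

(** The affine hull of S is closed, so it already contains the closure of S. *)
Lemma affine_hull_sub_closure (R : realType) (X : normedVectType R) (S E : set X) :
  S `<=` E -> E `<=` closure S -> affine_hull E = affine_hull S.
Proof.
move=> SE EclS; apply/seteqP; split.
  apply: smallest_sub; first exact: affine_hull_affine.
  apply: subset_trans EclS _.
  rewrite closureE; apply: smallest_sub; last exact: sub_gen_smallest.
  by apply: affine_closed; exact: affine_hull_affine.
apply: smallest_sub; first exact: affine_hull_affine.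
exact: subset_trans SE (@sub_gen_smallest _ _ _).
Qed.

Lemma relintP (R : realType) (X : normedModType R) (S : set X) (w : X) :
  relint S w -> S w /\ exists2 r, 0 < r &
    forall y, `|y| < r -> affine_hull S (w + y) -> S (w + y).
Proof.
move=> Sw; have Sw' : S w by exact: interior_subset Sw.
have affw : affine_hull S w by exact: sub_gen_smallest.
split => //; have : within (affine_hull S) (nbhs w) S.
  by rewrite nbhs_subspace_in.
move=> /nbhs_normP[r /= r0 rS].
exists r => // y yr; apply: rS.
by rewrite /= opprD addrA subrr add0r normrN.
Qed.

(** Since E and S have the same affine hull, relint E is open for the topology
that defines relint S; lying inside S, it lies inside relint S. *)
Lemma near_equal_of_sub (R : realType) (X : normedVectType R) (S E : set X) :
  S `<=` E -> E `<=` closure S -> relint E `<=` S -> near_equal S E.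
Proof.
move=> SE EclS rES; split.
  apply/seteqP; split; first exact: closureS.
  rewrite {1}closureE; apply: smallest_sub => //; exact: closed_closure.
have affES := affine_hull_sub_closure SE EclS.
apply/seteqP; split; first rewrite /relint affES.
  exact: (@interiorS (subspace (affine_hull S)) _ _ SE).
move: rES; rewrite /relint affES => rES.
have oE := @open_interior (subspace (affine_hull S)) E.
by move: rES; rewrite (open_subsetE _ oE).
Qed.

Lemma continuous_argmin (R : realType) (X : normedVectType R) (f : X -> R) (r : R) :
  0 <= r -> continuous f ->
  exists2 x, `|x| <= r & forall y, `|y| <= r -> f x <= f y.
Proof.
move=> r0 cf.
have [|x xr xmin] := compact_EVT_min _ (@closed_ball_compact_findim R X r)
    (continuous_subspaceT cf).
  by exists 0; rewrite /= normr0.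
by exists x => [|y yr]; [rewrite inE in xr|apply: xmin; rewrite inE].
Qed.

(** * The range of the displacement of a nonexpansive map *)

Definition nonexpansive (R : realType) (X : normedModType R) (T : X -> X) : Prop :=
  forall x y : X, `|T x - T y| <= `|x - y|.

Lemma nonexpansive_continuous (R : realType) (X : normedModType R) (T : X -> X) :
  nonexpansive T -> continuous T.
Proof.
move=> Tne x; apply/cvgrPdist_lt => d d0; near=> y.
apply: le_lt_trans (Tne _ _) _; near: y.
exact: cvgr_dist_lt.
Unshelve. all: by end_near. Qed.

(** The solutions are the fixed points of the contraction
G x = (T x + w) / (1 + e).  G maps a large ball to itself, and a minimizer x of
|x - G x| on this ball is fixed: otherwise G x would do strictly better. *)
Lemma resolvent_exists (R : realType) (X : normedVectType R) (T : X -> X)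
    (w : X) (e : R) :
  nonexpansive T -> 0 < e ->
  exists x, w = e *: x + (x - T x).
Proof.
move=> Tne e0; have q0 : 0 < 1 + e by lra.
pose G x := (1 + e)^-1 *: (T x + w).
have Glip x y : (1 + e) * `|G x - G y| <= `|x - y|.
  rewrite -scalerBr normrZ gtr0_norm ?invr_gt0// mulrA divff ?gt_eqF// mul1r.
  by rewrite opprD addrACA subrr addr0.
have cf : continuous (fun x => `|x - G x|).
  move=> x; apply: cvg_norm; apply: cvgB => //; apply: cvgZl_tmp; apply: cvgD; last exact: cvg_cst.
  exact: nonexpansive_continuous.
(* The radius solves |G 0| + r / (1 + e) = r. *)
pose r := (1 + e) / e * `|G 0|.
have r0 : 0 <= r by rewrite mulr_ge0// divr_ge0 ?ltW.
have Gr x : `|x| <= r -> `|G x| <= r.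
  move=> xr; have h := Glip x 0; rewrite subr0 in h.
  have h2 : `|G x| <= `|G x - G 0| + `|G 0|.
    by rewrite -{1}[G x](subrK (G 0)) ler_normD.
  have er : e * r = (1 + e) * `|G 0|.
    by rewrite /r mulrA [e * _]mulrC divfK// gt_eqF.
  nra.
have [x xr xmin] := continuous_argmin r0 cf.
have xG : `|x - G x| = 0.
  have := xmin _ (Gr _ xr); have := Glip x (G x); have := normr_ge0 (x - G x).
  nra.
exists x; have xE : x = G x by apply/eqP; rewrite -subr_eq0 -normr_eq0 xG.
have -> : e *: x + (x - T x) = (1 + e) *: x - T x.
  by rewrite scalerDl scale1r addrCA addrA.
by rewrite {1}xE scalerA divff ?gt_eqF// scale1r addrAC subrr add0r.
Qed.

(** The Brezis-Haraux condition: w is paired with some u for which (u, w) is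
within a bounded defect of being monotonically related to the graph of
Id - T. *)
Definition displacement_bounded_at (R : realType) (X : normedModType R)
    (inner : {dot X for idfun}) (T : X -> X) (w : X) : Prop :=
  exists u C, forall x, - C <= inner (w - (x - T x)) (u - x).

(** Evaluated at the solution x of w = e x + (x - T x), the condition reads
- C <= <e x, u - x>, hence e |x|^2 <= C + e <x, u>; so e |x|^2 stays bounded as
e tends to 0, and |w - (x - T x)|^2 = e (e |x|^2) tends to 0. *)
Lemma range_closure (R : realType) (X : normedVectType R)
    (inner : {dot X for idfun}) (Hinner : inner_norm inner) (T : X -> X) (w : X) :
  nonexpansive T ->
  displacement_bounded_at inner T w -> closure (range (id \- T)) w.
Proof.
move=> Tne [u [C uC]] B /nbhs_normP[r /= r0 rB].
(* K bounds e |x|^2 for all e <= 1. *)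
pose K := 2 * `|C| + `|u| ^+ 2 + 1.
have K0 : 0 < K by rewrite /K; have := sqr_ge0 `|u|; have := normr_ge0 C; lra.
pose e := Num.min 1 (r ^+ 2 / K / 2).
have e0 : 0 < e.
  by rewrite lt_min ltr01 !divr_gt0// exprn_gt0.
have e1 : e <= 1 by rewrite ge_min lexx.
have eK : e * K < r ^+ 2.
  have : e <= r ^+ 2 / K / 2 by rewrite ge_min lexx orbT.
  rewrite ler_pdivlMr// ler_pdivlMr// => h.
  have : 0 < r ^+ 2 by rewrite exprn_gt0.
  have : 0 < e * K by rewrite mulr_gt0.
  lra.
have [x xE] := resolvent_exists w Tne e0.
exists (x - T x); split; first by exists x.
apply: rB; rewrite /= {1}xE addrK normrZ gtr0_norm//.
have := uC x; rewrite {1}xE addrK linearZl_LR /= linearBr /= -Hinner.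
have := cauchy_schwarz Hinner x u; have := ler_norm C.
have := normr_ge0 x; have := normr_ge0 u => u0 x0 Cn xu h.
have h1 : e * `|x| ^+ 2 <= `|C| + e * (`|x| * `|u|) by nra.
have h2 : e * `|x| ^+ 2 < K.
  have : `|x| * `|u| <= (`|x| ^+ 2 + `|u| ^+ 2) / 2.
    by have := sqr_ge0 (`|x| - `|u|); nra.
  rewrite /K; have := sqr_ge0 `|u|; nra.
rewrite -ltr_sqr ?nnegrE ?mulr_ge0//; [|exact: ltW..].
nra.
Qed.

(** For w in relint E the solutions x of w = e x + (x - T x), e <= 1, stay
bounded: they lie in the direction U of the affine hull, and for v in U the
condition at w + d v, with d small, bounds d <v, x>.  On a ball containing them
all, the minimum of |w - (x - T x)| is at most e times the radius for every
e. *)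
Lemma relint_range (R : realType) (X : normedVectType R)
    (inner : {dot X for idfun}) (Hinner : inner_norm inner) (T : X -> X)
    (E : set X) :
  nonexpansive T ->
  range (id \- T) `<=` E -> E `<=` displacement_bounded_at inner T ->
  relint E `<=` range (id \- T).
Proof.
move=> Tne SE Ebd w /relintP[Ew [r r0 rE]].
have affE x : affine_hull E (x - T x).
  by apply: sub_gen_smallest; apply: SE; exists x.
have [U UE] := affine_direction (@affine_hull_affine _ _ E) (sub_gen_smallest Ew).
pose P := [set x | exists e : R, [/\ 0 < e, e <= 1 & w = e *: x + (x - T x)]].
have PU x : P x -> x \in U.
  move=> [e [e0 _ wE]]; have : - (e *: x) \in U.
    by apply/UE; rewrite wE addrAC subrr add0r.
  by rewrite memvN => /(memvZ e^-1); rewrite scalerA mulVf ?scale1r// gt_eqF.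
(* At w + d v the condition reads - C <= <e x + d v, u - x>, where the terms in
   e contribute at most |u|^2. *)
have PM v : v \in U -> exists c, forall x, P x -> inner v x <= c.
  move=> vU; have [d d0 dv] : exists2 d, 0 < d & `|d *: v| < r.
    have v1 : 0 < `|v| + 1 by have := normr_ge0 v; lra.
    exists (r / (`|v| + 1) / 2); first by rewrite !divr_gt0.
    rewrite normrZ gtr0_norm ?divr_gt0// mulrAC ltr_pdivrMr// mulrAC.
    by rewrite ltr_pdivrMr//; have := normr_ge0 v; nra.
  have /Ebd[u [C uC]] : E (w + d *: v).
    by apply: rE => //; apply/UE; rewrite memvZ.
  exists ((C + d * inner v u + `|u| ^+ 2) / d) => x [e [e0 e1 wE]].
  rewrite ler_pdivlMr//; have := uC x.
  rewrite addrAC {1}wE addrK linearDl /= !linearZl_LR /= !linearBr /= -Hinner.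
  have := ler_wpM2l (ltW e0) (cauchy_schwarz Hinner x u).
  have : e * (`|x| * `|u|) <= e * `|x| ^+ 2 + `|u| ^+ 2.
    have : `|x| * `|u| <= `|x| ^+ 2 + `|u| ^+ 2.
      by have := sqr_ge0 (`|x| - `|u|); have := sqr_ge0 (`|x| + `|u|); nra.
    by have := sqr_ge0 `|u|; nra.
  lra.
have [M0 PM0] := bounded_of_inner Hinner PU PM.
pose M := Num.max M0 0.
have cf : continuous (fun x => `|w - (x - T x)|).
  move=> x; apply: cvg_norm; apply: cvgB; first exact: cvg_cst.
  by apply: cvgB => //; exact: nonexpansive_continuous.
have M_ge0 : 0 <= M by rewrite le_max lexx orbT.
have [x xM xmin] := continuous_argmin M_ge0 cf.
exists x => //=; apply/eqP; rewrite -subr_eq0 -normr_eq0 distrC.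
rewrite eq_le normr_ge0 andbT; apply/ler_addgt0Pr => e e0; rewrite add0r.
pose e' := Num.min 1 (e / (M + 1)).
have M1 : 0 < M + 1 by lra.
have e'0 : 0 < e' by rewrite lt_min ltr01 divr_gt0.
have [y yE] := resolvent_exists w Tne e'0.
have yM : `|y| <= M.
  rewrite le_max PM0//; exists e'; split => //.
  by rewrite ge_min lexx.
apply: le_trans (xmin _ yM) _; rewrite {1}yE addrK normrZ gtr0_norm//.
have : e' <= e / (M + 1) by rewrite ge_min lexx orbT.
rewrite ler_pdivlMr//; nra.
Qed.

Lemma near_equal_range (R : realType) (X : normedVectType R)
    (inner : {dot X for idfun}) (Hinner : inner_norm inner) (T : X -> X)
    (E : set X) :
  nonexpansive T ->
  range (id \- T) `<=` E -> E `<=` displacement_bounded_at inner T ->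
  near_equal (range (id \- T)) E.
Proof.
move=> Tne SE Ebd; apply: near_equal_of_sub => //.
  by move=> w /Ebd; exact: range_closure.
exact: relint_range Ebd.
Qed.

(** * The Douglas-Rachford operator *)

Lemma firmly_nonexpansive_compl (R : realType) (X : normedModType R) (T : X -> X) :
  firmly_nonexpansive T -> firmly_nonexpansive (id \- T).
Proof. by move=> h x y; rewrite addrC /= !subKr; exact: h. Qed.

(** When T is the resolvent of a maximally monotone operator A, the pairs
(T z, z - T z) run through the graph of A, and this says that A is rectangular,
also called 3* monotone. *)
Definition rectangular (R : realType) (X : normedModType R)
    (inner : {dot X for idfun}) (T : X -> X) : Prop :=
  forall x y, exists C, forall z,
    - C <= inner (T x - T z) ((y - T y) - (z - T z)).

Lemma rectangular_compl (R : realType) (X : normedModType R)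
    (inner : {dot X for idfun}) (T : X -> X) :
  rectangular inner T -> rectangular inner (id \- T).
Proof.
move=> h x y; have [C hC] := h y x; exists C => z.
by rewrite /= !subKr inner_sym; exact: hC.
Qed.

Lemma rectangular_ereal_inf (R : realType) (X : normedModType R)
    (inner : {dot X for idfun}) (T : X -> X) :
  (forall x y : X, (-oo < ereal_inf
    [set (inner (T x - T z) ((y - T y) - (z - T z)))%:E | z in [set: X]])%E) ->
  rectangular inner T.
Proof.
move=> h x y; have lb z : (ereal_inf
    [set (inner (T x - T z) ((y - T y) - (z - T z)))%:E | z in [set: X]] <=
    (inner (T x - T z) ((y - T y) - (z - T z)))%:E)%E.
  by apply: ereal_inf_lbound; exists z.
move: (h x y) lb; case: ereal_inf => [c||] // _ lb; last by have := lb 0.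
by exists (- c) => z; rewrite opprK -lee_fin.
Qed.

Definition douglas_rachford (R : realType) (X : normedModType R) (T1 T2 : X -> X)
    : X -> X :=
  ((T2 \o (2 \*: T1 \- id)) \+ id) \- T1.

Lemma douglas_rachford_displ (R : realType) (X : normedModType R)
    (T1 T2 : X -> X) (x : X) :
  x - douglas_rachford T1 T2 x = T1 x - T2 (2 *: T1 x - x).
Proof. by rewrite /douglas_rachford /= opprB addrC opprD addrA subrK. Qed.

Lemma douglas_rachford_displ_dual (R : realType) (X : normedModType R)
    (T1 T2 : X -> X) (x : X) (y := 2 *: T1 x - x) :
  x - douglas_rachford T1 T2 x = (x - T1 x) + (y - T2 y).
Proof.
rewrite douglas_rachford_displ -/y addrA; congr (_ - _).
by rewrite /y scaler_nat mulr2n addrC addrA subrK addrK.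
Qed.

(** Passing from T2 to Id - T2 inverts the second monotone operator, which
exchanges the operator and its displacement. *)
Lemma douglas_rachford_compl (R : realType) (X : normedModType R)
    (T1 T2 : X -> X) :
  id \- douglas_rachford T1 (id \- T2) = douglas_rachford T1 T2.
Proof.
apply/funext => x; rewrite /= douglas_rachford_displ /=.
rewrite /douglas_rachford /= opprB addrCA -addrA; congr (_ + _).
by rewrite scaler_nat mulr2n opprB addrCA opprD addNKr.
Qed.

(** For differences d = x - y, a of T1 and b of T2, the operator produces
b + d - a, and adding the firm inequalities for a and b gives
|b + d - a|^2 <= <d, b + d - a>. *)
Lemma douglas_rachford_nonexpansive (R : realType) (X : normedModType R)
    (inner : {dot X for idfun}) (Hinner : inner_norm inner) (T1 T2 : X -> X) :
  firmly_nonexpansive T1 -> firmly_nonexpansive T2 ->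
  nonexpansive (douglas_rachford T1 T2).
Proof.
move=> /(firmly_nonexpansiveP Hinner) h1 /(firmly_nonexpansiveP Hinner) h2 x y.
pose d := x - y; pose a := T1 x - T1 y.
pose b := T2 (2 *: T1 x - x) - T2 (2 *: T1 y - y).
have E : douglas_rachford T1 T2 x - douglas_rachford T1 T2 y = b + d - a.
  rewrite /douglas_rachford /= opprD addrACA -opprD; congr (_ - _).
  by rewrite opprD addrACA.
have ha : `|a| ^+ 2 <= inner d a by exact: h1.
have hb : `|b| ^+ 2 <= 2 * inner a b - inner d b.
  apply: le_trans (h2 _ _) _; rewrite opprD addrACA -opprD -scalerBr -/a -/d -/b.
  by rewrite linearBl linearZl_LR.
rewrite E -/d; move: d a b {E} ha hb => d a b ha hb.
have h : `|b + d - a| ^+ 2 <= inner d (b + d - a).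
  rewrite (normB2 Hinner) (normD2 Hinner) [inner (b + d) a]linearDl /=.
  rewrite linearBr /= linearDr /= (Hinner d).
  rewrite (inner_sym inner b d) (inner_sym inner b a).
  lra.
have := cauchy_schwarz Hinner d (b + d - a).
have := normr_ge0 d; have := normr_ge0 (b + d - a); nra.
Qed.

(** Let w = T1 p - T2 q = (s - T1 s) + (t - T2 t) and u = T1 p + (s - T1 s).
With a = T1 p - T1 x, a' = (s - T1 s) - (x - T1 x) and e = w - F x, where F is
the displacement, the differences for T2 are a - e and e - a', so that
<e, u - x> = <e, a + a'> = <a, a'> + <a - e, e - a'> + |e|^2,
and the first two terms are bounded below by rectangularity. *)
Lemma douglas_rachford_displ_bounded (R : realType) (X : normedModType R)
    (inner : {dot X for idfun}) (Hinner : inner_norm inner) (T1 T2 : X -> X) :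
  rectangular inner T1 -> rectangular inner T2 ->
  minkowski_sub (range T1) (range T2) `&`
    minkowski_add (range (id \- T1)) (range (id \- T2)) `<=`
  displacement_bounded_at inner (douglas_rachford T1 T2).
Proof.
move=> r1 r2 w [[_ [p _ <-] [_ [q _ <-] wpq]] [_ [s _ <-] [_ [t _ <-] wst]]].
rewrite /= in wst.
have [C1 h1] := r1 p s; have [C2 h2] := r2 q t.
exists (T1 p + (s - T1 s)), (C1 + C2) => x.
have {h1} := h1 x; have {h2} := h2 (2 *: T1 x - x).
set y := 2 *: T1 x - x.
set e := w - (x - _).
pose a := T1 p - T1 x; pose a' := s - T1 s - (x - T1 x).
have -> : T2 q - T2 y = a - e.
  rewrite /e -wpq douglas_rachford_displ -/y.
  by rewrite [- (T1 x - T2 y)]opprD addrACA -opprD subKr.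
have -> : t - T2 t - (y - T2 y) = e - a'.
  rewrite /e -wst douglas_rachford_displ_dual -/y.
  by rewrite [- (x - T1 x + _)]opprD addrACA [X in X - a']addrC addrK.
have -> : T1 p + (s - T1 s) - x = a + a'.
  by rewrite /a /a' addrACA -opprD [T1 x + _]addrC subrK.
rewrite -/a -/a'; move: e a a' => e a a'.
rewrite linearBl /= !linearBr /= linearDr /= (inner_sym inner a e).
by have := sqr_ge0 `|e|; rewrite Hinner; lra.
Qed.

Lemma douglas_rachford_range_displ (R : realType) (X : normedVectType R)
    (inner : {dot X for idfun}) (Hinner : inner_norm inner) (T1 T2 : X -> X) :
  firmly_nonexpansive T1 -> firmly_nonexpansive T2 ->
  rectangular inner T1 -> rectangular inner T2 ->
  near_equal (range (id \- douglas_rachford T1 T2))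
    (minkowski_sub (range T1) (range T2) `&`
     minkowski_add (range (id \- T1)) (range (id \- T2))).
Proof.
move=> f1 f2 r1 r2; apply: (near_equal_range Hinner).
- exact: (douglas_rachford_nonexpansive Hinner).
- move=> _ [x _ <-] /=; split.
    rewrite douglas_rachford_displ.
    by exists (T1 x); [exists x|exists (T2 (2 *: T1 x - x)); [eexists|]].
  rewrite douglas_rachford_displ_dual.
  exists (x - T1 x); first by exists x.
  by exists ((id \- T2) (2 *: T1 x - x)); first by eexists.
- exact: douglas_rachford_displ_bounded.
Qed.

Theorem corollary6p8 (R : realType) (X : normedVectType R)
    (inner : {dot X for idfun}) (Hinner : inner_norm inner)
    (T1 T2 : X -> X)
    (HT1 : firmly_nonexpansive T1) (HT2 : firmly_nonexpansive T2)
    (Hinf1 : forall x y : X,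
      (-oo < ereal_inf
        [set (inner (T1 x - T1 z) ((y - T1 y) - (z - T1 z)))%:E | z in [set: X]])%E)
    (Hinf2 : forall x y : X,
      (-oo < ereal_inf
        [set (inner (T2 x - T2 z) ((y - T2 y) - (z - T2 z)))%:E | z in [set: X]])%E) :
  let T : X -> X := ((T2 \o (2 \*: T1 \- id)) \+ id) \- T1 in
  near_equal (range T)
    (minkowski_sub (range T1) (range (id \- T2)) `&`
     minkowski_add (range (id \- T1)) (range T2)) /\
  near_equal (range (id \- T))
    (minkowski_sub (range T1) (range T2) `&`
     minkowski_add (range (id \- T1)) (range (id \- T2))).
Proof.
move=> T; have r1 := rectangular_ereal_inf Hinf1.
have r2 := rectangular_ereal_inf Hinf2.
split; last exact: (douglas_rachford_range_displ Hinner).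
have := douglas_rachford_range_displ Hinner HT1 (firmly_nonexpansive_compl HT2)
  r1 (rectangular_compl r2).
have -> : id \- (id \- T2) = T2 by apply/funext => x /=; rewrite subKr.
by rewrite douglas_rachford_compl.
Qed.
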